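(* Let $X$ be a compact metric space, let $\mu$ be a Borel probability measure on $X$, and let $f: X\to X$ be a homeomorphism. Then $f$ is $\mu$-expansive if and only if the diagonal $\Delta=\{(x,x):x\in X\}$ is a $\mu^2$-isolated set of $f\times f: X\times X\to X\times X$, where $\mu^2=\mu\times\mu$ is the product measure.
   Context: For a homeomorphism $f$ of a metric space $(X,d)$, $x\in X$ and $\delta>0$, put $\Gamma_\delta(x)=\{y\in X: d(f^i(x),f^i(y))\leq\delta \text{ for all } i\in\mathbb{Z}\}$. Given a Borel probability measure $\mu$ on $X$, $f$ is called $\mu$-expansive if there is $\delta>0$ such that $\mu(\Gamma_\delta(x))=0$ for all $x\in X$. The product map is $(f\times f)(x,y)=(f(x),f(y))$, and $X\times X$ carries the metric $d((x_1,y_1),(x_2,y_2))=d(x_1,x_2)+d(y_1,y_2)$. For a bijective map $g$ of a metric space $Y$ and a Borel probability measure $\nu$ on $Y$, an invariant set $I\subset Y$ (i.e. $g(I)=I$) is called $\nu$-isolated if there is a compact neighborhood $U$ of $I$ such that $\nu(\{z\in Y: g^n(z)\in U \text{ for all } n\in\mathbb{Z}\})=0$. *)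

(* Defs.v *)
From HB Require Import structures.
From mathcomp Require Import all_boot all_order all_algebra.
From mathcomp Require Import all_classical all_reals all_analysis.

Set Implicit Arguments.
Unset Strict Implicit.
Unset Printing Implicit Defensive.

Import Order.TTheory GRing.Theory Num.Theory.
Import numFieldNormedType.Exports.

Local Open Scope classical_set_scope.
Local Open Scope ring_scope.

(* Measurable types are pointed in the library, hence so are the metric spaces
   considered here; a space carrying a probability measure is never empty. *)
#[short(type="pmetricType")]
HB.structure Definition PointedMetric (R : numDomainType) :=
  {T of Metric R T & isPointed T}.

(* The Borel sigma-algebra of a topological space. *)
Notation borel T := (g_sigma_algebraType (@open T)).

(* The product X * Y with the metric d((x1, y1), (x2, y2)) = d(x1, x2) + d(y1, y2).
   An alias is needed because the library already equips X * Y with the balls of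
   the max metric. *)
Definition sumprod (X Y : Type) : Type := (X * Y)%type.

Section sumprod_metric.
Context {R : realType} (X Y : pmetricType R).

Definition sumprod_dist (p q : X * Y) : R := mdist p.1 q.1 + mdist p.2 q.2.

Lemma sumprod_dist_refl p : sumprod_dist p p = 0.
Proof. by rewrite /sumprod_dist !mdistxx addr0. Qed.

Lemma sumprod_dist_pos p q : sumprod_dist p q = 0 -> p = q.
Proof.
case: p q => [x y] [x' y'] /eqP.
rewrite /sumprod_dist paddr_eq0 ?mdist_ge0//=.
by move=> /andP[/eqP/mdist_positivity-> /eqP/mdist_positivity->].
Qed.

Lemma sumprod_dist_sym p q : sumprod_dist p q = sumprod_dist q p.
Proof. by rewrite /sumprod_dist metric_sym [X in _ + X]metric_sym. Qed.

Lemma sumprod_dist_triangle q p r :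
  sumprod_dist p r <= sumprod_dist p q + sumprod_dist q r.
Proof. by rewrite /sumprod_dist addrACA lerD// metric_triangle. Qed.

HB.instance Definition _ := Choice.on (sumprod X Y).
HB.instance Definition _ := isPointed.Build (sumprod X Y) (point, point).
HB.instance Definition _ := isMetric.Build R (sumprod X Y)
  sumprod_dist_refl sumprod_dist_pos sumprod_dist_sym sumprod_dist_triangle.

Lemma sumprod_nbhsE (p : X * Y) : @nbhs _ (sumprod X Y) p = nbhs p.
Proof.
apply/seteqP; split => A.
- move=> /nbhs_ballP[e /= e0 pA].
  have e20 : 0 < e / 2 by rewrite divr_gt0.
  exists (ball p.1 (e / 2), ball p.2 (e / 2)) => /=.
    by split; exact: nbhsx_ballx.
  move=> [x y] /= []; rewrite !ballEmdist/= => px py; apply: pA.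
  by rewrite ballEmdist/= [ltRHS]splitr; exact: ltrD.
- move=> [[P Q] /= [/nbhs_ballP[e /= e0 eP] /nbhs_ballP[r /= r0 rQ]] PQA].
  apply/nbhs_ballP; exists (Num.min e r); first by rewrite /= lt_min e0 r0.
  move=> [x y]; rewrite ballEmdist/= {1}/mdist/= /sumprod_dist/= lt_min.
  move=> /andP[xe yr].
  apply: PQA; split => /=; [apply: eP|apply: rQ]; rewrite ballEmdist/=.
    by rewrite (le_lt_trans _ xe)// lerDl mdist_ge0.
  by rewrite (le_lt_trans _ yr)// lerDr mdist_ge0.
Qed.

Lemma sumprod_openE (A : set (X * Y)) : @open (sumprod X Y) A = open A.
Proof.
rewrite !openE/=; apply/propext; split=> oA p /oA.
  by rewrite /interior/= sumprod_nbhsE.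
by rewrite /interior/= sumprod_nbhsE.
Qed.

End sumprod_metric.

(* On compact metric spaces the Borel sigma-algebra of the product is the product
   of the Borel sigma-algebras, so that the product measure is a Borel measure. *)
Section product_borel.
Context {R : realType} (X Y : pmetricType R).
Hypotheses (cX : compact [set: X]) (cY : compact [set: Y]).

Let borel_id (p : borel X * borel Y) : borel (sumprod X Y) := p.

Lemma measurable_borel_id : measurable_fun setT borel_id.
Proof.
apply: (@measurability _ _ (borel X * borel Y)%type (borel (sumprod X Y))
  setT borel_id open erefl) => _ [A oA <-]; rewrite setTI.
have -> : borel_id @^-1` A = A by [].
have [BX cBX [oBX bX]] := @compact_second_countable R X cX.
have [BY cBY [oBY bY]] := @compact_second_countable R Y cY.
pose S := [set PQ | (BX `*` BY) PQ /\ PQ.1 `*` PQ.2 `<=` A].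
have AE : A = \bigcup_(PQ in S) (PQ.1 `*` PQ.2).
  apply/seteqP; split => [[x y] Axy|p [PQ [_ PQA] /PQA//]].
  move: oA; rewrite sumprod_openE openE => /(_ _ Axy)[[P Q] /= [xP yQ] PQA].
  have [U [BU Ux] UP] := bX _ _ xP; have [V [BV Vy] VQ] := bY _ _ yQ.
  exists (U, V) => //; split => // -[a b] /= [Ua Vb].
  by apply: PQA; split; [exact: UP|exact: VQ].
have cS : countable S.
  by apply: sub_countable (countableX cBX cBY); apply: subset_card_le => ? [].
have [S0|[/= h]] := elimT pfcard_geP cS; first by rewrite AE S0 bigcup_set0.
rewrite AE (_ : \bigcup_(_ in _) _ = \bigcup_n ((h n).1 `*` (h n).2)).
  apply: bigcupT_measurable => n.
  have [[BXn BYn] _] : S (h n) by exact: funS.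
  by apply: measurableX; apply: sub_sigma_algebra; [exact: oBX|exact: oBY].
apply/seteqP; split => [p [PQ /(@surj _ _ _ _ h)[n _ <-] hp]|p [n _ hp]].
  by exists n.
by exists (h n) => //; exact: funS.
Qed.

HB.instance Definition _ :=
  isMeasurableFun.Build _ _ _ _ borel_id measurable_borel_id.

Definition prod_borel (mu : probability (borel X) R)
    (nu : probability (borel Y) R) : probability (borel (sumprod X Y)) R :=
  distribution (mu \x nu)%E borel_id.

Lemma prod_borelE mu nu A : prod_borel mu nu A = (mu \x nu)%E A.
Proof. by []. Qed.

End product_borel.

(* An element of {splitbij [set: T] >-> [set: T]} is a bijection g of T bundled
   with its inverse g^-1. Below, iterz g n is g^n for n : int; recall that
   Negz k is - k.+1. *)
Definition iterz {T : Type} (g : {splitbij [set: T] >-> [set: T]}) (n : int) :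
    T -> T :=
  match n with
  | Posz k => iter k g
  | Negz k => iter k.+1 g^-1%FUN
  end.

Definition homeomorphism {T : topologicalType}
    (f : {splitbij [set: T] >-> [set: T]}) :=
  continuous f /\ continuous f^-1%FUN.

Definition Gamma {R : realType} {X : pmetricType R}
    (f : {splitbij [set: X] >-> [set: X]}) (delta : R) (x : X) : set X :=
  [set y | forall i : int, mdist (iterz f i x) (iterz f i y) <= delta].

Definition measure_expansive {R : realType} {X : pmetricType R}
    (mu : probability (borel X) R) (f : {splitbij [set: X] >-> [set: X]}) :=
  exists2 delta : R, 0 < delta & forall x, mu (Gamma f delta x) = 0%E.

Definition measure_isolated {R : realType} {Y : pmetricType R}
    (nu : probability (borel Y) R) (g : {splitbij [set: Y] >-> [set: Y]})
    (I : set Y) :=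
  g @` I = I /\
  exists U : set Y, [/\ compact U, set_nbhs I U &
    nu [set z | forall n : int, U (iterz g n z)] = 0%E].

(* f x f, with inverse f^-1 x f^-1. *)
Section square_map.
Context {X : Type} (f : {splitbij [set: X] >-> [set: X]}).

Definition square_map (p : sumprod X X) : sumprod X X := (f p.1, f p.2).

Let square_inv (p : sumprod X X) : sumprod X X := (f^-1%FUN p.1, f^-1%FUN p.2).

Let square_mapK : cancel square_map square_inv.
Proof. by move=> [x y]; rewrite /square_inv /square_map/= !funK ?inE. Qed.

Let square_invK : cancel square_inv square_map.
Proof. by move=> [x y]; rewrite /square_inv /square_map/= !invK ?inE. Qed.

HB.instance Definition _ := @Can2.Build _ _ setT setT square_map square_inv
  (fun _ _ => I) (fun _ _ => I) (in1W square_mapK) (in1W square_invK).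

End square_map.

(* Main.v *)
Require Import Defs.
From HB Require Import structures.
From mathcomp Require Import all_boot all_order all_algebra.
From mathcomp Require Import all_classical all_reals all_analysis.
From mathcomp Require Import lra.

Set Implicit Arguments.
Unset Strict Implicit.
Unset Printing Implicit Defensive.

Import Order.TTheory GRing.Theory Num.Theory.
Import numFieldNormedType.Exports.

Local Open Scope classical_set_scope.
Local Open Scope ring_scope.

(** Write [E d] for the set of pairs [(x, y)] whose orbits stay within [d] of
    each other for all integer times. The section of [E d] at [x] is
    [Gamma f d x], and [E d] is the set of points whose orbit under [f x f]
    never leaves the tube of pairs at distance at most [d].

    If all the sets [Gamma f d x] are null, then so is [E d], because the
    product measure integrates the measures of the sections; the tube is then an
    isolating neighborhood of the diagonal.

    Conversely a neighborhood [U] of the diagonal contains the tube of some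
    radius [d], by compactness ([diagonal_nbhs_tube]), and the orbits that stay
    in [U] form a null set. A priori this makes [Gamma f d x] null only for
    almost every [x]. Halving the radius removes the exceptional points: two
    points of [Gamma f (d / 2) x] shadow each other within [d], so the square
    of [Gamma f (d / 2) x] lies in that null set ([Gamma_half_square]), whence
    the square of its measure vanishes. *)

Lemma iterz_continuous (T : topologicalType)
    (g : {splitbij [set: T] >-> [set: T]}) (n : int) :
  homeomorphism g -> continuous (iterz g n).
Proof.
have iterC (h : T -> T) k : continuous h -> continuous (iter k h).
  move=> hc; elim: k => [|k IH] x; first exact: cvg_id.
  by apply: (@continuous_comp _ _ _ (iter k h) h); [exact: IH|exact: hc].
by case=> gc gic; case: n => k; exact: iterC.
Qed.

Lemma iterz_square (X : Type) (f : {splitbij [set: X] >-> [set: X]}) (n : int)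
    (p : sumprod X X) :
  iterz (square_map f) n p = (iterz f n p.1, iterz f n p.2).
Proof. by case: p => x y; case: n => k; elim: k => //= k ->. Qed.

Lemma square_map_diagonal (X : Type) (f : {splitbij [set: X] >-> [set: X]}) :
  square_map f @` diagonal = diagonal.
Proof.
apply/seteqP; split => [_ [p pp <-]|[x y] xy].
  by apply: (congr1 f); exact: pp.
exists (f^-1%FUN x, f^-1%FUN y); first exact: (congr1 f^-1%FUN xy).
by rewrite /square_map/= !invK ?inE.
Qed.

Lemma closed_measurable_borel (R : realType) (T : pmetricType R)
    (A : set (borel T)) : closed (A : set T) -> measurable A.
Proof.
move=> Ac; rewrite -[A]setCK; apply: measurableC.
by apply: sub_sigma_algebra; exact: closed_openC.
Qed.

(** A point of the closure lies within any [e > 0] of a point of the sublevel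
    set, so [phi] is at most [d + e] there. The triangle inequality
    makes [mdist] Lipschitz, in one variable and on pairs, so that closed balls
    and tubes are closed. *)
Lemma closed_sublevel_lipschitz (R : realType) (T : pmetricType R)
    (phi : T -> R) (d : R) :
  (forall y z, phi y <= phi z + mdist y z) -> closed [set y | phi y <= d].
Proof.
move=> phiL y yd; apply/ler_addgt0Pr => e e0.
have [z [/= zd]] := yd _ (nbhsx_ballx y e e0).
rewrite ballEmdist/= => yz.
by rewrite (le_trans (phiL y z))// lerD// ltW.
Qed.

Section square.
Context {R : realType} {X : pmetricType R}.

Definition tube (d : R) : set (sumprod X X) := [set p | mdist p.1 p.2 <= d].

Lemma closed_tube d : closed (tube d).
Proof.
apply: closed_sublevel_lipschitz => p q.
rewrite {3}/mdist/= /sumprod_dist addrCA.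
rewrite (le_trans (metric_triangle p.1 q.1 p.2))// lerD2l.
by rewrite (metric_sym p.2) metric_triangle.
Qed.

Lemma tube_nbhs (d : R) : 0 < d -> @set_nbhs (sumprod X X) diagonal (tube d).
Proof.
move=> d0 [x y]; rewrite /diagonal/= => ->; apply/nbhs_ballP.
exists d => [|[a b]]; first exact: d0.
rewrite ballEmdist /tube/= {1}/mdist/= /sumprod_dist/= => yab.
by rewrite (le_trans (metric_triangle a y b))// [X in X + _]metric_sym ltW.
Qed.

Lemma compact_sumprod :
  compact [set: X] -> compact [set: sumprod X X].
Proof.
move=> cX; have := compact_setX cX cX; rewrite setXTT => cXX F FF FT.
have [p [_ Fp]] := cXX F FF FT; exists p; split => // A B FA.
by rewrite sumprod_nbhsE; exact: Fp.
Qed.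

(** The Lebesgue number argument: each point of the diagonal has a ball inside
    the neighborhood, and compactness makes the radius uniform. For the latter, the property of [x]
    and [e] that all pairs [(x, y)] with [y] within [e] of [x] lie in [U] is
    shown locally in [x] and for small [e] at once. *)
Lemma diagonal_nbhs_tube (U : set (sumprod X X)) :
  compact [set: X] -> @set_nbhs (sumprod X X) diagonal U ->
  exists2 d : R, 0 < d & tube d `<=` U.
Proof.
move=> /compact_near_coveringP cX dU.
have nU : forall x, [set: X] x -> \forall x' \near x & e \near 0^'+,
    forall y, mdist x' y <= e -> U (x', y).
  move=> x _; have /nbhs_ballP[r /= r0 rU] := dU (x, x) erefl.
  (* The distance from [(x, x)] to [(x', y)] is [d(x, x') + d(x, y)], and the
     second term costs another [d(x, x')] besides [d(x', y)]: three thirds. *)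
  have r3 : 0 < r / 3 by rewrite divr_gt0.
  exists (ball x (r / 3), [set e : R | e < r / 3]) => /=.
    by split; [exact: nbhsx_ballx|exact: nbhs_right_lt].
  move=> [x' e] /= []; rewrite ballEmdist/= => xx' er y x'y; apply: rU.
  rewrite ballEmdist/= {1}/mdist/= /sumprod_dist/=.
  have -> : r = r / 3 + (r / 3 + r / 3) by lra.
  rewrite ltrD// (le_lt_trans (metric_triangle x x' y))// ltrD//.
  exact: le_lt_trans x'y er.
have nV := cX _ _ _ (at_right_proper_filter 0) nU.
have [d [d0 dV]] := filter_ex (filterI (nbhs_right_gt 0) nV).
by exists d => // -[x y] /= xy; exact: dV.
Qed.

Context (f : {splitbij [set: X] >-> [set: X]}).

(** The metric of [sumprod] defines the product topology, so continuity is
    checked for the two coordinates separately. *)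
Lemma homeomorphism_square :
  homeomorphism f -> homeomorphism (square_map f).
Proof.
have sqC (h : X -> X) : continuous h ->
    continuous (fun p : sumprod X X => (h p.1, h p.2) : sumprod X X).
  move=> hc p; have : h q.1 @[q --> (p : X * X)] --> h p.1.
    by apply: (@continuous_comp _ _ _ fst h); [exact: cvg_fst|exact: hc].
  have : h q.2 @[q --> (p : X * X)] --> h p.2.
    by apply: (@continuous_comp _ _ _ snd h); [exact: cvg_snd|exact: hc].
  move=> h2 h1; have h12 := cvg_pair h1 h2.
  move=> A; rewrite sumprod_nbhsE => /h12.
  by rewrite !nbhs_filterE/= sumprod_nbhsE.
by case=> fc fic; split; exact: sqC.
Qed.

Lemma closed_Gamma d x : homeomorphism f -> closed (Gamma f d x).
Proof.
move=> hf; have -> : Gamma f d x =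
    \bigcap_i iterz f i @^-1` [set y | mdist (iterz f i x) y <= d].
  by apply/seteqP; split => [y xy i _|y xy i]; exact: xy.
apply: closed_bigI => i _.
have /continuous_closedP := iterz_continuous (n := i) hf; apply.
apply: closed_sublevel_lipschitz => y z.
by rewrite [X in _ + X]metric_sym metric_triangle.
Qed.

(** This makes the set of orbits that stay in a compact neighborhood of the
    diagonal measurable, so that its measure bounds those of its subsets. *)
Lemma closed_maximal_invariant (U : set (sumprod X X)) :
  homeomorphism f -> closed U ->
  closed [set p | forall n : int, U (iterz (square_map f) n p)].
Proof.
move=> hf Uc; have -> : [set p | forall n : int, U (iterz (square_map f) n p)] =
    \bigcap_n iterz (square_map f) n @^-1` U.
  by apply/seteqP; split => [p Up i _|p Up i]; exact: Up.
apply: closed_bigI => i _.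
have /iterz_continuous/continuous_closedP := homeomorphism_square hf.
exact.
Qed.

Lemma xsection_shadowing d x :
  xsection [set p | forall n : int, tube d (iterz (square_map f) n p)] x =
  Gamma f d x.
Proof.
apply/seteqP; split => y; rewrite /xsection/= inE => h n.
  by have := h n; rewrite iterz_square.
by rewrite iterz_square; exact: h.
Qed.

(** The triangle inequality through the orbit of [x], at each time. *)
Lemma Gamma_half_square d x :
  Gamma f (d / 2) x `*` Gamma f (d / 2) x `<=`
  [set p | forall n : int, tube d (iterz (square_map f) n p)].
Proof.
move=> [y z] /= [xy xz] n; rewrite iterz_square /tube/=.
rewrite (le_trans (metric_triangle _ (iterz f n x) _))//.
by rewrite [leRHS]splitr lerD// metric_sym.
Qed.

End square.

Theorem theorem3p5 (R : realType) (X : pmetricType R)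
    (compactX : compact [set: X]) (mu : probability (borel X) R)
    (f : {splitbij [set: X] >-> [set: X]}) (homeo_f : homeomorphism f) :
  measure_expansive mu f <->
  measure_isolated (prod_borel compactX compactX mu mu) (square_map f)
    (diagonal : set (sumprod X X)).
Proof.
split=> [[d d0 mu0]|[_ [U [cU dU mu0]]]].
  split; first exact: square_map_diagonal.
  exists (tube d); split; last 1 first.
  - rewrite prod_borelE; apply: integral0_eq => x _ /=.
    by rewrite xsection_shadowing mu0.
  - exact: subclosed_compact (@closed_tube _ _ d) (compact_sumprod compactX) _.
  - exact: tube_nbhs.
have [d d0 dV] := diagonal_nbhs_tube compactX dU.
exists (d / 2); first by rewrite divr_gt0.
move=> x; set G := Gamma f (d / 2) x.
have mG : measurable (G : set (borel X)).
  by apply: closed_measurable_borel; exact: closed_Gamma.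
have Uc : closed U := compact_closed (@metric_hausdorff _ _) cU.
have : ((mu \x mu) (G `*` G) <= 0)%E.
  rewrite -mu0; apply: (le_measure (mu \x mu)%E); rewrite ?inE.
  - exact: measurableX.
  - have := closed_measurable_borel (closed_maximal_invariant homeo_f Uc).
    (* from Borel sets of the product to the product sigma-algebra *)
    move=> /(measurable_borel_id compactX compactX measurableT).
    by rewrite setTI.
  - by move=> p /Gamma_half_square Gp n; exact: (dV _ (Gp n)).
rewrite product_measure1E// => GG0; apply/eqP.
by rewrite -[_ == _]orbb -mule_eq0 eq_le GG0 mule_ge0.
Qed.
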